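(* Let $W\subseteq\mathcal{L}_\Sigma$ be a finite set of formulas and $\varphi$ a formula in $\mathcal{L}_\Sigma$. Let $D_W=\{\delta_p\mid p\in\mathit{var}(W)\}$ and $D_\varphi=\{\delta_p\mid p\in\mathit{var}(\varphi)\setminus\mathit{var}(W)\}$, and consider the default theories $T=(D_W,W^\pm)$ and $T'=(D_W,W^\pm\cup c(D_\varphi))$. Write $D_W=\{\delta_1,\ldots,\delta_n\}$, let $G=\{g_1,\ldots,g_n\}$ be the indexed set of globally new variables corresponding to $D_W$, let $G'=\{g'_1,\ldots,g'_n\}$ be a further set of globally new variables, and let $$\Psi=\bigwedge_{i=1}^{n}\Big(\neg g'_i\to\exists G\big(\mathcal{E}xt[T]\wedge\neg\,\mathcal{C}onseq[T,c(\delta_i)]\big)\Big).$$ Then the paraconsistent signed consequence relations are axiomatised by QBFs as follows: 1. $W\vdash^\pm_c\varphi$ iff $\models\exists G(\mathcal{E}xt[T]\wedge\mathcal{C}onseq[T',\varphi^\pm])$; 2. $W\vdash^\pm_s\varphi$ iff $\models\neg\exists G(\mathcal{E}xt[T]\wedge\neg\,\mathcal{C}onseq[T',\varphi^\pm])$; and 3. $W\vdash^\pm_p\varphi$ iff $\models\neg\exists G'(\Psi\wedge\neg\,\mathcal{C}onseq_{G\leftarrow G'}[T',\varphi^\pm])$, where $\mathcal{C}onseq_{G\leftarrow G'}[T',\varphi^\pm]$ denotes the QBF obtained from $\mathcal{C}onseq[T',\varphi^\pm]$ by replacing each occurrence of an atom $g_i\in G$ by $g'_i$.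
   Context: Propositional language $\mathcal{L}_\Sigma$ over alphabet $\Sigma$; $\mathit{var}(\cdot)$ is the set of atoms occurring in a formula/set; $\mathrm{Cn}(\cdot)$ is classical deductive closure. $\Sigma^\pm=\{p^+,p^-\mid p\in\Sigma\}$ is a disjoint alphabet; for $\alpha\in\mathcal{L}_\Sigma$, $\alpha^\pm$ is obtained by replacing each positive occurrence of an atom $p$ by $p^+$ and each negative occurrence by $\neg p^-$ (likewise for sets). For each $p\in\Sigma$ the default $\delta_p$ has empty (tautological) prerequisite, justification $j(\delta_p)=(p^+\equiv\neg p^-)$, and consequent $c(\delta_p)=(p\equiv p^+)\wedge(\neg p\equiv p^-)$; for a set $D$ of defaults $j(D)$, $c(D)$ are the sets of justifications/consequents. With $D_\Sigma=\{\delta_p\mid p\in\Sigma\}$, $\mathcal{E}$ the set of Reiter extensions of $(D_\Sigma,W^\pm)$, and $\Pi_E=\{c(\delta_p)\mid p\in\Sigma,\ \neg j(\delta_p)\notin E\}$: $W\vdash^\pm_c\varphi$ iff $\varphi^\pm\in\bigcup_{E\in\mathcal{E}}\mathrm{Cn}(W^\pm\cup\Pi_E)$; $W\vdash^\pm_s\varphi$ iff $\varphi^\pm\in\bigcap_{E\in\mathcal{E}}\mathrm{Cn}(W^\pm\cup\Pi_E)$; $W\vdash^\pm_p\varphi$ iff $\varphi^\pm\in\mathrm{Cn}(W^\pm\cup\bigcap_{E\in\mathcal{E}}\Pi_E)$. QBF modules: for indexed sets $S=\{\phi_1,\ldots,\phi_n\}$, $R=\{\psi_1,\ldots,\psi_n\}$,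 $S\le R$ abbreviates $\bigwedge_{i=1}^n(\phi_i\to\psi_i)$. For finite sets $T_0$ and $S=\{\phi_1,\ldots,\phi_n\}$ with associated variables $G=\{g_1,\ldots,g_n\}$, $\mathcal{C}[T_0,S]=\exists P\,(T_0\wedge(G\le S))$ where $P=\mathit{var}(S\cup T_0)$. For a default theory $T=(D,V)$ with $D=\{\delta_1,\ldots,\delta_n\}$ and associated new variables $g_1,\ldots,g_n$: $\mathcal{E}xt[T]=\mathcal{C}[V,j(D)]\wedge\bigwedge_{i=1}^n\big(\neg g_i\to\neg\,\mathcal{C}[V\cup\{j(\delta_i)\},j(D\setminus\{\delta_i\})]\big)$, and $\mathcal{C}onseq[T,\varphi]=\forall P\big(V\wedge(G\le c(D))\to\varphi\big)$ where $P$ is the set of atoms occurring in $T$ or $\varphi$. *)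

(* Defs.v *)
From HB Require Import structures.
From mathcomp Require Import all_boot.

Set Implicit Arguments.
Unset Strict Implicit.
Unset Printing Implicit Defensive.

(* There are no truth constants: if falsum could occur in W, the signed theory *)
(* would not always be satisfiable. Equivalence is an abbreviation, so that every *)
(* atom occurrence has exactly one polarity.                                   *)
Inductive form (A : Type) : Type :=
| Var of A
| Not of form A
| And of form A & form A
| Or of form A & form A
| Imp of form A & form A.

Definition Iff (A : Type) (f g : form A) : form A := And (Imp f g) (Imp g f).

Fixpoint var (A : Type) (f : form A) : seq A :=
  match f with
  | Var a => [:: a]
  | Not f => var f
  | And f g | Or f g | Imp f g => var f ++ var g
  end.

Definition vars (A : Type) (S : seq (form A)) : seq A :=
  flatten [seq var f | f <- S].

Definition fset (A : Type) := form A -> Prop.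

Fixpoint set_of_seq (A : Type) (S : seq (form A)) : fset A :=
  fun f => if S is g :: S' then f = g \/ set_of_seq S' f else False.
Definition unionf (A : Type) (S S' : fset A) : fset A := fun f => S f \/ S' f.
Definition addf (A : Type) (S : fset A) (g : form A) : fset A :=
  fun f => f = g \/ S f.

Inductive derives (A : Type) : fset A -> form A -> Prop :=
| DHyp S f : S f -> derives S f
| DImpI S f g : derives (addf S f) g -> derives S (Imp f g)
| DImpE S f g : derives S (Imp f g) -> derives S f -> derives S g
| DAndI S f g : derives S f -> derives S g -> derives S (And f g)
| DAndE1 S f g : derives S (And f g) -> derives S f
| DAndE2 S f g : derives S (And f g) -> derives S g
| DOrI1 S f g : derives S f -> derives S (Or f g)
| DOrI2 S f g : derives S g -> derives S (Or f g)
| DOrE S f g h : derives S (Or f g) -> derives (addf S f) h ->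
    derives (addf S g) h -> derives S h
| DNotI S f g : derives (addf S f) g -> derives (addf S f) (Not g) ->
    derives S (Not f)
| DNotNotE S f : derives S (Not (Not f)) -> derives S f.

Definition Cn (A : Type) (S : fset A) : fset A := fun f => derives S f.

(* [pre d = None] is the empty (tautological) prerequisite.                    *)
Record default (A : Type) : Type := Default {
  pre : option (form A);
  jus : form A;
  con : form A
}.

Definition opt_in (A : Type) (S : fset A) (o : option (form A)) : Prop :=
  if o is Some f then S f else True.

(* Closure conditions of Reiter's operator Gamma at the context E.             *)
Definition reiter_closed (A : Type) (D : default A -> Prop) (V E S : fset A) :
    Prop :=
  [/\ forall f, V f -> S f,
      forall f, Cn S f -> S f
    & forall d, D d -> opt_in S (pre d) -> ~ E (Not (jus d)) -> S (con d)].

Definition Gamma (A : Type) (D : default A -> Prop) (V E : fset A) : fset A :=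
  fun f => forall S : fset A, reiter_closed D V E S -> S f.

Definition extension (A : Type) (D : default A -> Prop) (V E : fset A) : Prop :=
  forall f, E f <-> Gamma D V E f.

(* The alphabet Sigma together with its signed copies p^+ and p^-.             *)
Inductive satom (Sigma : Type) : Type :=
| Orig of Sigma
| Plus of Sigma
| Minus of Sigma.

Definition satom_code (Sigma : Type) (a : satom Sigma) : Sigma + (Sigma + Sigma) :=
  match a with
  | Orig p => inl p
  | Plus p => inr (inl p)
  | Minus p => inr (inr p)
  end.
Definition satom_decode (Sigma : Type) (a : Sigma + (Sigma + Sigma)) : satom Sigma :=
  match a with
  | inl p => Orig p
  | inr (inl p) => Plus p
  | inr (inr p) => Minus p
  end.
Lemma satom_codeK (Sigma : Type) :
  cancel (@satom_code Sigma) (@satom_decode Sigma).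
Proof. by case. Qed.
HB.instance Definition _ (Sigma : eqType) :=
  Equality.copy (satom Sigma) (can_type (@satom_codeK Sigma)).

(* [pol] is the polarity of the current subformula.                            *)
Fixpoint signed_at (Sigma : Type) (pol : bool) (f : form Sigma) :
    form (satom Sigma) :=
  match f with
  | Var p => if pol then Var (Plus p) else Not (Var (Minus p))
  | Not f => Not (signed_at (~~ pol) f)
  | And f g => And (signed_at pol f) (signed_at pol g)
  | Or f g => Or (signed_at pol f) (signed_at pol g)
  | Imp f g => Imp (signed_at (~~ pol) f) (signed_at pol g)
  end.

Definition signed (Sigma : Type) (f : form Sigma) : form (satom Sigma) :=
  signed_at true f.
Definition signed_seq (Sigma : Type) (W : seq (form Sigma)) :
    seq (form (satom Sigma)) := [seq signed f | f <- W].

Definition delta (Sigma : Type) (p : Sigma) : default (satom Sigma) :=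
  {| pre := None;
     jus := Iff (Var (Plus p)) (Not (Var (Minus p)));
     con := And (Iff (Var (Orig p)) (Var (Plus p)))
                (Iff (Not (Var (Orig p))) (Var (Minus p))) |}.

Definition D_all (Sigma : Type) : default (satom Sigma) -> Prop :=
  fun d => exists p : Sigma, d = delta p.

Definition signed_ext (Sigma : Type) (W : seq (form Sigma))
    (E : fset (satom Sigma)) : Prop :=
  extension (@D_all Sigma) (set_of_seq (signed_seq W)) E.

Definition Pi (Sigma : Type) (E : fset (satom Sigma)) : fset (satom Sigma) :=
  fun f => exists p : Sigma, f = con (delta p) /\ ~ E (Not (jus (delta p))).

Definition cred_conseq (Sigma : Type) (W : seq (form Sigma)) (f : form Sigma) :
    Prop :=
  exists E, signed_ext W E /\
    Cn (unionf (set_of_seq (signed_seq W)) (Pi E)) (signed f).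

Definition skep_conseq (Sigma : Type) (W : seq (form Sigma)) (f : form Sigma) :
    Prop :=
  forall E, signed_ext W E ->
    Cn (unionf (set_of_seq (signed_seq W)) (Pi E)) (signed f).

Definition prud_conseq (Sigma : Type) (W : seq (form Sigma)) (f : form Sigma) :
    Prop :=
  Cn (unionf (set_of_seq (signed_seq W))
             (fun g => forall E, signed_ext W E -> Pi E g)) (signed f).

Inductive qbf (A : Type) : Type :=
| qTop
| qVar of A
| qNot of qbf A
| qAnd of qbf A & qbf A
| qOr of qbf A & qbf A
| qImp of qbf A & qbf A
| qEx of A & qbf A
| qAll of A & qbf A.
Arguments qTop {A}.

Definition upd (A : eqType) (v : A -> bool) (a : A) (b : bool) : A -> bool :=
  fun x => if x == a then b else v x.

Fixpoint qeval (A : eqType) (v : A -> bool) (q : qbf A) : bool :=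
  match q with
  | qTop => true
  | qVar a => v a
  | qNot q => ~~ qeval v q
  | qAnd q r => qeval v q && qeval v r
  | qOr q r => qeval v q || qeval v r
  | qImp q r => qeval v q ==> qeval v r
  | qEx a q => qeval (upd v a true) q || qeval (upd v a false) q
  | qAll a q => qeval (upd v a true) q && qeval (upd v a false) q
  end.

Definition qvalid (A : eqType) (q : qbf A) : Prop := forall v, qeval v q.

(* Applied to free and bound atoms alike.                                      *)
Fixpoint qrename (A B : Type) (h : A -> B) (q : qbf A) : qbf B :=
  match q with
  | qTop => qTop
  | qVar a => qVar (h a)
  | qNot q => qNot (qrename h q)
  | qAnd q r => qAnd (qrename h q) (qrename h r)
  | qOr q r => qOr (qrename h q) (qrename h r)
  | qImp q r => qImp (qrename h q) (qrename h r)
  | qEx a q => qEx (h a) (qrename h q)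
  | qAll a q => qAll (h a) (qrename h q)
  end.

Definition qconj (A : Type) (s : seq (qbf A)) : qbf A := foldr (@qAnd A) qTop s.
Definition qexs (A : Type) (s : seq A) (q : qbf A) : qbf A := foldr (@qEx A) q s.
Definition qalls (A : Type) (s : seq A) (q : qbf A) : qbf A :=
  foldr (@qAll A) q s.

(* The alphabet A extended by the new variables g_i and g'_i.                  *)
Inductive gatom (A : Type) : Type :=
| Base of A
| Guess of nat
| Guess' of nat.
Arguments Guess {A} _.
Arguments Guess' {A} _.

Definition gatom_code (A : Type) (a : gatom A) : A + (nat + nat) :=
  match a with
  | Base p => inl p
  | Guess i => inr (inl i)
  | Guess' i => inr (inr i)
  end.
Definition gatom_decode (A : Type) (a : A + (nat + nat)) : gatom A :=
  match a with
  | inl p => Base p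
  | inr (inl i) => Guess i
  | inr (inr i) => Guess' i
  end.
Lemma gatom_codeK (A : Type) : cancel (@gatom_code A) (@gatom_decode A).
Proof. by case. Qed.
HB.instance Definition _ (A : eqType) :=
  Equality.copy (gatom A) (can_type (@gatom_codeK A)).

Fixpoint qform (A : Type) (f : form A) : qbf (gatom A) :=
  match f with
  | Var a => qVar (Base a)
  | Not f => qNot (qform f)
  | And f g => qAnd (qform f) (qform g)
  | Or f g => qOr (qform f) (qform g)
  | Imp f g => qImp (qform f) (qform g)
  end.

(* A finite set of formulas, read as the conjunction of its elements.          *)
Definition qset (A : Type) (S : seq (form A)) : qbf (gatom A) :=
  qconj [seq qform f | f <- S].

Definition qle (A : Type) (S R : seq (qbf A)) : qbf A :=
  qconj [seq qImp x.1 x.2 | x <- zip S R].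

Definition qatoms (A : eqType) (s : seq A) : seq (gatom A) :=
  [seq Base a | a <- undup s].

Definition C_mod (A : eqType) (T0 S : seq (form A)) (G : seq (gatom A)) :
    qbf (gatom A) :=
  qexs (qatoms (vars (S ++ T0)))
    (qAnd (qset T0) (qle [seq qVar g | g <- G] [seq qform f | f <- S])).

(* Finite default theories with an indexed set of n defaults.                  *)
Record dtheory (A : Type) (n : nat) : Type := DTheory {
  dflt : 'I_n -> default A;
  facts : seq (form A)
}.

Definition guesses (A : Type) (n : nat) : seq (gatom A) :=
  [seq Guess (nat_of_ord i) | i <- enum 'I_n].
Definition guesses' (A : Type) (n : nat) : seq (gatom A) :=
  [seq Guess' (nat_of_ord i) | i <- enum 'I_n].

Definition Ext_mod (A : eqType) (n : nat) (T : dtheory A n) : qbf (gatom A) :=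
  qAnd
    (C_mod (facts T) [seq jus (dflt T i) | i <- enum 'I_n] (guesses A n))
    (qconj
       [seq qImp (qNot (qVar (Guess (nat_of_ord i))))
                 (qNot (C_mod (rcons (facts T) (jus (dflt T i)))
                    [seq jus (dflt T k) | k <- enum 'I_n & k != i]
                    [seq Guess (nat_of_ord k) | k <- enum 'I_n & k != i]))
       | i <- enum 'I_n]).

Definition default_var (A : Type) (d : default A) : seq A :=
  (if pre d is Some f then var f else [::]) ++ var (jus d) ++ var (con d).

Definition dtheory_var (A : Type) (n : nat) (T : dtheory A n) : seq A :=
  flatten [seq default_var (dflt T i) | i <- enum 'I_n] ++ vars (facts T).

Definition Conseq_mod (A : eqType) (n : nat) (T : dtheory A n) (f : form A) :
    qbf (gatom A) :=
  qalls (qatoms (dtheory_var T ++ var f))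
    (qImp (qAnd (qset (facts T))
                (qle [seq qVar g | g <- guesses A n]
                     [seq qform (con (dflt T i)) | i <- enum 'I_n]))
          (qform f)).

Definition prime_guess (A : Type) (a : gatom A) : gatom A :=
  if a is Guess i then Guess' i else a.

(* T = (D_W, W^+-) and T' = (D_W, W^+- u c(D_f)); p enumerates var(W).         *)
Definition thy (Sigma : Type) (n : nat) (p : 'I_n -> Sigma)
    (W : seq (form Sigma)) : dtheory (satom Sigma) n :=
  {| dflt := fun i => delta (p i); facts := signed_seq W |}.

Definition thy' (Sigma : eqType) (n : nat) (p : 'I_n -> Sigma)
    (W : seq (form Sigma)) (f : form Sigma) : dtheory (satom Sigma) n :=
  {| dflt := fun i => delta (p i);
     facts := signed_seq W ++
              [seq con (delta q) | q <- undup (var f) & q \notin vars W] |}.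

Definition Psi (A : eqType) (n : nat) (T : dtheory A n) : qbf (gatom A) :=
  qconj
    [seq qImp (qNot (qVar (Guess' (nat_of_ord i))))
              (qexs (guesses A n)
                 (qAnd (Ext_mod T) (qNot (Conseq_mod T (con (dflt T i))))))
    | i <- enum 'I_n].

(* Main.v *)
Require Import Defs.
From mathcomp Require Import all_boot.
From mathcomp Require Import boolp classical_sets.

(** The defaults have no prerequisites, so E is an extension iff it is the
    theory of W^± together with the consequents of the defaults applied in E.
    The justification of [delta q] is the part of its consequent that does not
    mention q itself, and a valuation satisfying the justification can be
    changed at q to satisfy the consequent; so a set of defaults is the set
    applied in some extension iff it is maximal among the sets whose
    justifications are jointly satisfiable with W^±.  The default of an atom
    outside var(W) belongs to every such set, which leaves the maximal sets of
    defaults over var(W), and these are what [Ext_mod] expresses.  By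
    completeness of natural deduction, which holds for infinite theories too,
    [Conseq_mod] then expresses derivability.
    For prudent consequence, [Psi] holds of G' iff G' contains every default
    common to all extensions; as entailment is monotone in G', quantifying over
    all such G' amounts to testing that intersection. *)

Set Implicit Arguments.
Unset Strict Implicit.
Unset Printing Implicit Defensive.

Local Open Scope classical_set_scope.

Fixpoint feval (A : Type) (v : A -> bool) (f : form A) : bool :=
  match f with
  | Var a => v a
  | Not f => ~~ feval v f
  | And f g => feval v f && feval v g
  | Or f g => feval v f || feval v g
  | Imp f g => feval v f ==> feval v g
  end.

Definition satisfies (A : Type) (v : A -> bool) (S : fset A) : Prop :=
  forall f, S f -> feval v f.

Definition adjoin (A I : Type) (V : fset A) (F : I -> form A) (X : set I) :
    fset A :=
  unionf V (F @` X).

Section DirectedUnions.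
Variables (A I : Type).
Implicit Types (S U : fset A) (X : I -> fset A) (P Q : fset A -> Prop).

Definition directed X : Prop :=
  forall i j, exists2 k, X i `<=` X k & X j `<=` X k.

(* Asking for all supersets of [X i], rather than for [X i] alone, is what    *)
(* lets premises derived at different indices be combined.                    *)
Definition eventually X P : Prop := exists i, forall S, X i `<=` S -> P S.

Lemma addf_subset S S' (f : form A) : S `<=` S' -> addf S f `<=` addf S' f.
Proof. by move=> SS' g [->|/SS']; [left|right]. Qed.

Lemma directed_addf X f : directed X -> directed (fun i => addf (X i) f).
Proof.
by move=> dirX i j; have [k ik jk] := dirX i j; exists k; apply: addf_subset.
Qed.

Lemma eventually_addf X P f :
  eventually (fun i => addf (X i) f) P -> eventually X (fun S => P (addf S f)).
Proof. by move=> [i XP]; exists i => S /(@addf_subset _ _ f)/XP. Qed.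

Lemma eventually_and X P Q : directed X ->
  eventually X P -> eventually X Q -> eventually X (fun S => P S /\ Q S).
Proof.
move=> dirX [i XP] [j XQ]; have [k ik jk] := dirX i j; exists k => S kS.
by split; [apply: XP|apply: XQ]; apply: subset_trans kS.
Qed.

Lemma eventually_imp X P Q :
  (forall S, P S -> Q S) -> eventually X P -> eventually X Q.
Proof. by move=> PQ [i XP]; exists i => S /XP/PQ. Qed.

Definition eventually_derives U f : Prop :=
  forall X, directed X -> U `<=` \bigcup_i X i ->
    eventually X (fun S => derives S f).

Hypothesis I_inhabited : inhabited I.

Lemma addf_subset_bigcup X U f :
  U `<=` \bigcup_i X i -> addf U f `<=` \bigcup_i addf (X i) f.
Proof.
have [i0] := I_inhabited => UX g [->|/UX[i _ Xg]].
  by exists i0 => //; left.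
by exists i => //; right.
Qed.

Lemma eventually_derives_addf X U f g : eventually_derives (addf U f) g ->
  directed X -> U `<=` \bigcup_i X i ->
  eventually X (fun S => derives (addf S f) g).
Proof.
move=> Ufg dirX UX; apply: (@eventually_addf _ (fun S => derives S g)).
by apply: Ufg; [apply: directed_addf|apply: addf_subset_bigcup].
Qed.

Lemma derives_directed U f : derives U f -> eventually_derives U f.
Proof.
elim=> {}U {}f.
- by move=> Uf X _ /(_ _ Uf)[i _ Xf]; exists i => S /(_ _ Xf); apply: DHyp.
- move=> g _ IH X dirX /(eventually_derives_addf IH dirX).
  by apply: eventually_imp => S; apply: DImpI.
- move=> g _ IHfg _ IHf X dirX UX.
  have := eventually_and dirX (IHfg _ dirX UX) (IHf _ dirX UX).
  by apply: eventually_imp => S []; apply: DImpE.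
- move=> g _ IHf _ IHg X dirX UX.
  have := eventually_and dirX (IHf _ dirX UX) (IHg _ dirX UX).
  by apply: eventually_imp => S []; apply: DAndI.
- move=> g _ IH X dirX /(IH _ dirX).
  by apply: eventually_imp => S; apply: DAndE1.
- move=> g _ IH X dirX /(IH _ dirX).
  by apply: eventually_imp => S; apply: DAndE2.
- move=> g _ IH X dirX /(IH _ dirX).
  by apply: eventually_imp => S; apply: DOrI1.
- move=> g _ IH X dirX /(IH _ dirX).
  by apply: eventually_imp => S; apply: DOrI2.
- move=> g h _ IHor _ IHf _ IHg X dirX UX.
  have := eventually_and dirX (IHor _ dirX UX)
    (eventually_and dirX (eventually_derives_addf IHf dirX UX)
                         (eventually_derives_addf IHg dirX UX)).
  by apply: eventually_imp => S [+ []]; apply: DOrE.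
- move=> g _ IHg _ IHng X dirX UX.
  have := eventually_and dirX (eventually_derives_addf IHg dirX UX)
                              (eventually_derives_addf IHng dirX UX).
  by apply: eventually_imp => S []; apply: DNotI.
- move=> _ IH X dirX /(IH _ dirX).
  by apply: eventually_imp => S; apply: DNotNotE.
Qed.

End DirectedUnions.

Section Completeness.
Variable A : Type.
Implicit Types (S V : fset A) (f g h : form A) (v : A -> bool).

Lemma derives_mono S S' f : S `<=` S' -> derives S f -> derives S' f.
Proof.
move=> SS' d; pose X (_ : unit) := S.
have dirX : directed X by move=> i j; exists i.
have SX : S `<=` \bigcup_i X i by move=> g Sg; exists tt.
by have [_ /(_ _ SS')] := derives_directed (inhabits tt) d dirX SX.
Qed.

Lemma derives_addf S f g : derives S g -> derives (addf S f) g.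
Proof. by apply: derives_mono => h; right. Qed.

Lemma derives_addf_hyp S f : derives (addf S f) f.
Proof. by apply: DHyp; left. Qed.

Lemma derives_explode S f g : derives S f -> derives S (Not f) -> derives S g.
Proof.
by move=> df dnf; apply/DNotNotE/(@DNotI _ _ _ f); apply: derives_addf.
Qed.

Lemma derives_cases S f g :
  derives (addf S f) g -> derives (addf S (Not f)) g -> derives S g.
Proof.
move=> /DImpI dfg /DImpI dnfg; apply/DNotNotE/(@DNotI _ _ _ g).
  apply: DImpE (derives_addf _ dnfg) _; apply: (@DNotI _ _ _ g).
    by apply: DImpE (derives_addf_hyp _ _); do 2 apply: derives_addf.
  by apply: derives_addf; apply: derives_addf_hyp.
exact: derives_addf_hyp.
Qed.

Lemma satisfies_addf v S f :
  satisfies v S -> feval v f -> satisfies v (addf S f).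
Proof. by move=> vS vf g [->|/vS]. Qed.

Lemma derives_sound S f v : derives S f -> satisfies v S -> feval v f.
Proof.
elim=> {}S {}f /=.
- by move=> Sf; apply.
- by move=> g _ IH vS; apply/implyP => vf; apply/IH/satisfies_addf.
- by move=> g _ IHfg _ IHf vS; apply: (implyP (IHfg vS)); apply: IHf.
- by move=> g _ IHf _ IHg vS; rewrite IHf ?IHg.
- by move=> g _ IH /IH/andP[].
- by move=> g _ IH /IH/andP[].
- by move=> g _ IH /IH ->.
- by move=> g _ IH /IH ->; rewrite orbT.
- move=> g h _ IHor _ IHf _ IHg vS.
  by case/orP: (IHor vS) => ?; [apply: IHf|apply: IHg]; apply: satisfies_addf.
- move=> g _ IHg _ IHng vS; apply/negP => vf.
  have vSf := satisfies_addf vS vf.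
  by have /negP := IHng vSf; apply; apply: IHg.
- by move=> _ IH /IH; rewrite negbK.
Qed.

Lemma adjoin_mono (I : Type) V (F : I -> form A) (X Y : set I) :
  X `<=` Y -> adjoin V F X `<=` adjoin V F Y.
Proof. by move=> XY g [|[i /XY Yi <-]]; [left|right; exists i]. Qed.

Lemma exists_maximal_nonderiving (I : Type) (V : fset A) (F : I -> form A) f :
    ~ derives V f ->
  exists2 X : set I, ~ derives (adjoin V F X) f &
    forall i, ~ derives (addf (adjoin V F X) (F i)) f -> X i.
Proof.
move=> nVf; pose avoids X := ~ derives (adjoin V F X) f.
have [C Cavoids Ctot|X [Xavoids maxX]] := @Zorn_bigcup I avoids.
  have [[X0 CX0]|C0] := pselect (exists X, C X); last first.
    apply: contra_not nVf; apply: derives_mono => g [//|[i [X CX]]].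
    by case: C0; exists X.
  pose Y (X : {X | C X}) := adjoin V F (sval X).
  have dirY : directed Y.
    move=> X X'; have [XX'|X'X] := Ctot _ _ (svalP X) (svalP X').
      by exists X' => //; apply: adjoin_mono.
    by exists X => //; apply: adjoin_mono.
  have sub : adjoin V F (\bigcup_(X in C) X) `<=` \bigcup_X Y X.
    move=> g [Vg|[i [X CX Xi] <-]].
      by exists (exist _ X0 CX0) => //; left.
    by exists (exist _ X CX) => //; right; exists i.
  have inhC : inhabited {X | C X} := inhabits (exist _ X0 CX0).
  move=> /(derives_directed inhC)/(_ Y dirY sub)[[X CX]].
  by move=> /(_ _ (@subset_refl _ _)); apply: Cavoids.
exists X => // i nXi; apply: contrapT => nX.
apply: (maxX (i |` X)); first by split=> [j|/(_ i (or_introl erefl))]; [right|].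
apply: contra_not nXi; apply: derives_mono => g [Vg|[j [->|Xj] <-]].
- by right; left.
- by left.
- by right; right; exists j.
Qed.

Definition negation_complete S : Prop :=
  forall f, derives S (Not f) <-> ~ derives S f.

Lemma lindenbaum S f : ~ derives S f ->
  exists M, [/\ S `<=` M, negation_complete M & ~ derives M f].
Proof.
move=> /(exists_maximal_nonderiving id)[X]; set M := adjoin S id X => nMf maxM.
have addM g : ~ M g -> derives (addf M g) f.
  by move=> nMg; apply: contrapT => /maxM Xg; apply: nMg; right; exists g.
have MNf : M (Not f).
  apply: contrapT => /addM dnf; apply: nMf.
  exact: derives_cases (derives_addf_hyp _ _) dnf.
exists M; split=> [g Sg|g|//]; first by left.
split=> [dng dg|ndg]; first exact/nMf/(derives_explode _ dg dng).
apply: (@DNotI _ _ _ f); last by apply: DHyp; right.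
by apply: addM => Mg; apply/ndg/DHyp.
Qed.

Definition theory_valuation S (a : A) : bool := `[< derives S (Var a) >].

Lemma feval_theory_valuation S f : negation_complete S ->
  feval (theory_valuation S) f <-> derives S f.
Proof.
move=> complS; elim: f => [a|f IH|f IHf g IHg|f IHf g IHg|f IHf g IHg] /=.
- by split=> /asboolP.
- by rewrite complS -IH; split=> /negP.
- split=> [/andP[/IHf df /IHg dg]|d]; first exact: DAndI.
  by apply/andP; split; [apply/IHf/DAndE1/d|apply/IHg/DAndE2/d].
- split=> [/orP[/IHf|/IHg]|dor]; [exact: DOrI1|exact: DOrI2|].
  apply/orP; have [df|/complS dnf] := pselect (derives S f).
    by left; apply/IHf.
  right; apply/IHg/(DOrE dor); last exact: derives_addf_hyp.
  exact: derives_explode _ (derives_addf_hyp _ _) (derives_addf _ dnf).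
- split=> [/implyP fg|dimp]; last by apply/implyP => /IHf /(DImpE dimp)/IHg.
  apply: DImpI; have [/IHf/fg/IHg|/complS dnf] := pselect (derives S f).
    exact: derives_addf.
  exact: derives_explode _ (derives_addf_hyp _ _) (derives_addf _ dnf).
Qed.

Theorem derivesP S f : derives S f <-> forall v, satisfies v S -> feval v f.
Proof.
split=> [d v|Sf]; first exact: derives_sound.
apply: contrapT => /lindenbaum[M [SM complM nMf]].
apply/nMf/(feval_theory_valuation _ complM)/Sf => g /SM Mg.
exact/(feval_theory_valuation _ complM)/DHyp.
Qed.

End Completeness.

Section MaximalConsistency.
Variables (A I : Type).
Implicit Types (V S : fset A) (F : I -> form A) (X : set I) (v : A -> bool).

Definition satisfiable S : Prop := exists v, satisfies v S.

Definition max_consistent V F X : Prop :=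
  satisfiable (adjoin V F X) /\
  forall i v, satisfies v (adjoin V F X) -> feval v (F i) -> X i.

Lemma satisfies_adjoin v V F X : satisfies v (adjoin V F X) <->
  satisfies v V /\ forall i, X i -> feval v (F i).
Proof.
split=> [vVX|[vV vX] f [/vV //|[i /vX vi <-] //]].
by split=> [f Vf|i Xi]; apply: vVX; [left|right; exists i].
Qed.

Lemma satisfiable_nonderiving S f :
  satisfiable S <-> ~ derives S (And f (Not f)).
Proof.
rewrite derivesP; split=> [[v vS] /(_ v vS) /=|nS]; first by rewrite andbN.
by apply: contrapT => nsat; apply: nS => v vS; case: nsat; exists v.
Qed.

Lemma max_consistent_exists V F :
  satisfiable V -> exists X, max_consistent V F X.
Proof.
move=> satV; have [[i0 _]|I0] := pselect (exists i : I, True); last first.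
  have [v vV] := satV; exists set0; split=> [|i]; last by case: I0; exists i.
  by exists v; apply/satisfies_adjoin; split=> [//|i []].
move/(satisfiable_nonderiving _ (F i0))/(exists_maximal_nonderiving F): satV.
move=> [X /satisfiable_nonderiving satX maxX]; exists X; split=> // i v vX vi.
by apply/maxX/satisfiable_nonderiving; exists v; apply: satisfies_addf.
Qed.

End MaximalConsistency.

Section PrerequisiteFreeDefaults.
Variables (A I : Type) (V : fset A) (D : I -> default A).
Implicit Types (E : fset A) (X : set I).

Definition applied E : set I := [set i | ~ E (Not (jus (D i)))].

Definition theory_of X : fset A := Cn (adjoin V (@con _ \o D) X).

Lemma theory_ofP X f : theory_of X f <->
  forall v, satisfies v (adjoin V (@con _ \o D) X) -> feval v f.
Proof. exact: derivesP. Qed.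

Hypothesis prerequisite_free : forall i, pre (D i) = None.

Lemma Gamma_theory_of E :
  Gamma (fun d => exists i, d = D i) V E = theory_of (applied E).
Proof.
apply/predeqP => f; split=> [|/theory_ofP Xf S [VS CnS DS]].
  apply; split=> [g Vg|g /derivesP dg|_ [i ->] _ Ei].
  - by apply: DHyp; left.
  - by apply/derivesP => v vX; apply: dg => h /derivesP; apply.
  - by apply: DHyp; right; exists i.
apply/CnS/derivesP => v vS; apply/Xf/satisfies_adjoin.
split=> [g /VS /vS //|i Ei]; apply/vS/DS => //; first by exists i.
by rewrite prerequisite_free.
Qed.

Lemma extensionE E :
  extension (fun d => exists i, d = D i) V E <-> E = theory_of (applied E).
Proof. by rewrite /extension Gamma_theory_of predeqP. Qed.

Definition self_supporting : Prop :=
  (forall i v, feval v (con (D i)) -> feval v (jus (D i))) /\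
  forall v, satisfies v V -> exists2 w, satisfies w V &
    forall i, feval v (jus (D i)) -> feval w (con (D i)).

Hypothesis D_supported : self_supporting.

Lemma satisfies_jus_of_con v X :
  satisfies v (adjoin V (@con _ \o D) X) ->
  satisfies v (adjoin V (@jus _ \o D) X).
Proof.
move=> /satisfies_adjoin[vV vX]; apply/satisfies_adjoin; split=> // i /vX.
exact: D_supported.1.
Qed.

Lemma satisfies_con_of_jus v X : satisfies v (adjoin V (@jus _ \o D) X) ->
  exists2 w, satisfies w (adjoin V (@con _ \o D) X) &
    forall i, feval v (jus (D i)) -> feval w (con (D i)).
Proof.
move=> /satisfies_adjoin[/D_supported.2[w wV vw] vX]; exists w => //.
by apply/satisfies_adjoin; split=> // i /vX /vw.
Qed.

Lemma theory_of_con X i : max_consistent V (@jus _ \o D) X ->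
  theory_of X (con (D i)) <-> X i.
Proof.
move=> [[v /satisfies_con_of_jus[w wX _]] maxX].
split=> [/theory_ofP/(_ w wX)/D_supported.1 wi|Xi].
  exact: maxX (satisfies_jus_of_con wX) wi.
by apply: DHyp; right; exists i.
Qed.

Lemma max_consistent_fixpoint X : satisfiable V ->
  max_consistent V (@jus _ \o D) X <-> applied (theory_of X) = X.
Proof.
move=> [v0 v0V]; rewrite predeqP; split=> [[[v vX] maxX] i|fixX].
  rewrite /applied /= theory_ofP; split=> [nji|Xi dji].
    apply: contrapT => nXi; apply: nji => w wX; apply/negP => wi.
    exact/nXi/(maxX i w)/wi/satisfies_jus_of_con.
  have [w wX _] := satisfies_con_of_jus vX; have /negP := dji w wX; apply.
  by apply: D_supported.1; apply: wX; right; exists i.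
have refuted i w : satisfies w (adjoin V (@con _ \o D) X) ->
    feval w (jus (D i)) -> X i.
  by move=> wX wi; apply/fixX => /theory_ofP/(_ w wX)/negP.
split=> [|i v /satisfies_con_of_jus[w wX vw] /vw/D_supported.1]; last first.
  exact: refuted.
suff [w /satisfies_jus_of_con wX] : satisfiable (adjoin V (@con _ \o D) X).
  by exists w.
have [[i Xi]|X0] := pselect (exists i, X i).
  apply: contrapT => nsat; have /fixX := Xi; apply; apply/theory_ofP => w wX.
  by case: nsat; exists w.
exists v0; apply/satisfies_adjoin; split=> // i Xi.
by case: X0; exists i.
Qed.

Lemma applied_extensions : satisfiable V ->
  applied @` extension (fun d => exists i, d = D i) V =
  max_consistent V (@jus _ \o D).
Proof.
move=> satV; apply/predeqP => X; split=> [[E /extensionE Efix <-]|].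
  by apply/max_consistent_fixpoint => //; rewrite -Efix.
move=> /(max_consistent_fixpoint _ satV) fixX; exists (theory_of X) => //.
by apply/extensionE; rewrite fixX.
Qed.

End PrerequisiteFreeDefaults.

Section QBFSemantics.
Variable A : eqType.
Implicit Types (u v w : A -> bool) (q r : qbf A) (s : seq A).

Lemma eq_qeval v w q : v =1 w -> qeval v q = qeval w q.
Proof. by move=> /funext ->. Qed.

Lemma qeval_qAnd v q r : qeval v (qAnd q r) <-> qeval v q /\ qeval v r.
Proof. by split=> /andP. Qed.

Lemma qeval_qNot v q : qeval v (qNot q) <-> ~ qeval v q.
Proof. by split=> /negP. Qed.

Lemma qeval_qexs v s q : qeval v (qexs s q) <->
  exists2 w, (forall x, x \notin s -> w x = v x) & qeval w q.
Proof.
elim: s v => [|a s IH] v /=.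
  split=> [vq|[w wv]]; first by exists v.
  by rewrite (@eq_qeval w v) // => x; apply: wv.
split=> [/orP[]/IH[w wv wq]|[w wv wq]].
1,2: exists w => // x; rewrite inE negb_or => /andP[xa xs].
1,2: by rewrite wv // /upd (negbTE xa).
have : qeval (upd v a (w a)) (qexs s q).
  apply/IH; exists w => // x xs; rewrite /upd; case: eqP => [-> //|/eqP xa].
  by apply: wv; rewrite inE negb_or xa.
by case: (w a) => ->; rewrite ?orbT.
Qed.

Lemma qeval_qallsE v s q : qeval v (qalls s q) = ~~ qeval v (qexs s (qNot q)).
Proof. by elim: s v => [|a s IH] v /=; rewrite ?negbK // !IH negb_or. Qed.

Lemma qeval_qconj v (qs : seq (qbf A)) : qeval v (qconj qs) = all (qeval v) qs.
Proof. by elim: qs => //= q qs ->. Qed.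

Section FamiliesOfVariables.
Variables (I : finType) (c : I -> A) (P : set I -> Prop) (q : qbf A).
Hypothesis c_inj : injective c.
Hypothesis qP : forall u, qeval u q <-> P [set i | u (c i)].

Lemma qeval_qexs_family w :
  qeval w (qexs [seq c i | i <- enum I] q) <-> exists X, P X.
Proof.
rewrite qeval_qexs; split=> [[u _ /qP Pu]|[X PX]]; first by eexists; exact: Pu.
exists (fun x => if [pick i | c i == x] is Some i then `[< X i >] else w x).
  move=> x; case: pickP => // i /eqP <- /negP[].
  by apply: map_f; rewrite mem_enum.
apply/qP; congr P: PX; apply/predeqP => i /=; case: pickP => [j|/(_ i)].
  by move/eqP/c_inj ->; split=> /asboolP.
by rewrite eqxx.
Qed.

Lemma qvalid_qexs_family :
  qvalid (qexs [seq c i | i <- enum I] q) <-> exists X, P X.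
Proof.
split=> [/(_ xpredT)/qeval_qexs_family //|exX w].
exact/qeval_qexs_family.
Qed.

Lemma qvalid_qNot_qexs_family :
  qvalid (qNot (qexs [seq c i | i <- enum I] q)) <-> forall X, ~ P X.
Proof.
split=> [/(_ xpredT)/qeval_qNot nex X PX|allX w].
  by apply/nex/qeval_qexs_family; exists X.
by apply/qeval_qNot => /qeval_qexs_family[X]; apply: allX.
Qed.

End FamiliesOfVariables.

End QBFSemantics.

Fixpoint all_bound (A : Type) (P : pred A) (q : qbf A) : bool :=
  match q with
  | qTop | qVar _ => true
  | qNot q => all_bound P q
  | qAnd q r | qOr q r | qImp q r => all_bound P q && all_bound P r
  | qEx a q | qAll a q => P a && all_bound P q
  end.

Lemma all_bound_qalls (A : Type) (P : pred A) (s : seq A) (q : qbf A) :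
  all_bound P (qalls s q) = all P s && all_bound P q.
Proof. by elim: s => //= a s ->; rewrite andbA. Qed.

Lemma all_bound_qconj (A : Type) (P : pred A) (qs : seq (qbf A)) :
  all_bound P (qconj qs) = all (all_bound P) qs.
Proof. by elim: qs => //= q qs ->. Qed.

Lemma all_bound_qform (A : Type) (P : pred (gatom A)) (f : form A) :
  all_bound P (qform f).
Proof. by elim: f => //= [f ->|f -> g ->|f -> g ->]. Qed.

Lemma qeval_qrename (A B : eqType) (h : A -> B) (P : pred A) (w : B -> bool) q :
  (forall a x, P a -> h x = h a -> x = a) -> all_bound P q ->
  qeval w (qrename h q) = qeval (w \o h) q.
Proof.
move=> h_inj; have updh v a b : P a -> upd v (h a) b \o h =1 upd (v \o h) a b.
  move=> Pa x; rewrite /upd /=.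
  case: (x =P a) => [->|xa]; first by rewrite eqxx.
  by case: eqP => // /(h_inj _ _ Pa).
elim: q w => //= [q IH|q IHq r IHr|q IHq r IHr|q IHq r IHr|a q IH|a q IH] w.
1: by move=> /IH ->.
1-3: by move=> /andP[/IHq -> /IHr ->].
1-2: by move=> /andP[Pa /IH{}IH]; rewrite !IH !(eq_qeval _ (updh _ _ _ Pa)).
Qed.

Section EvaluationOfFormulas.
Variable A : eqType.
Implicit Types (v : A -> bool) (w : gatom A -> bool).
Implicit Types (S : fset A) (q : qbf (gatom A)).

Lemma eq_feval_in v v' (f : form A) :
  {in var f, v =1 v'} -> feval v f = feval v' f.
Proof.
elim: f => [a|f IH|f IHf g IHg|f IHf g IHg|f IHf g IHg] /= eq_v.
- by apply: eq_v; rewrite inE.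
- by rewrite IH.
all: by rewrite IHf ?IHg // => a af; apply: eq_v; rewrite mem_cat af ?orbT.
Qed.

Definition var_within (s : seq A) S : Prop :=
  forall f, S f -> {subset var f <= s}.

Lemma eq_satisfies_in v v' (s : seq A) S : var_within s S ->
  {in s, v =1 v'} -> satisfies v S -> satisfies v' S.
Proof.
move=> Ss eq_v vS f Sf; rewrite -(@eq_feval_in v) ?vS //.
by move=> a /(Ss f Sf)/eq_v.
Qed.

Lemma var_within_adjoin (I : Type) (s : seq A) S (F : I -> form A) (X : set I) :
  var_within s S -> (forall i, X i -> {subset var (F i) <= s}) ->
  var_within s (adjoin S F X).
Proof. by move=> Ss Fs f [/Ss|[i /Fs Xi <-]]. Qed.

Lemma var_within_vars (S : seq (form A)) (s : seq A) :
  {subset vars S <= s} -> var_within s (set_of_seq S).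
Proof.
elim: S => [_ f []|g S IH] /=; rewrite /vars /= => sub f [-> a ag|Sf].
  by apply: sub; rewrite mem_cat ag.
by apply: IH Sf => a aS; apply: sub; rewrite mem_cat aS orbT.
Qed.

Lemma var_subset_vars (I : eqType) (r : I -> form A) (t : seq I) i :
  i \in t -> {subset var (r i) <= vars [seq r j | j <- t]}.
Proof.
by move=> ti a ar; rewrite /vars -map_comp; apply/flatten_mapP; exists i.
Qed.

Lemma vars_cat (S S' : seq (form A)) : vars (S ++ S') = vars S ++ vars S'.
Proof. by rewrite /vars map_cat flatten_cat. Qed.

Lemma satisfies_set_of_seq v (S : seq (form A)) :
  satisfies v (set_of_seq S) <-> all (feval v) S.
Proof.
elim: S => [|g S IH] /=; first by split=> [//|_ f].
split=> [vgS|/andP[vg /IH vS] f [->|/vS] //].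
by apply/andP; split; [apply: vgS; left|apply/IH => f Sf; apply: vgS; right].
Qed.

Lemma satisfies_rcons v (S : seq (form A)) f :
  satisfies v (set_of_seq (rcons S f)) <->
  satisfies v (set_of_seq S) /\ feval v f.
Proof.
by rewrite !satisfies_set_of_seq all_rcons andbC; split=> /andP.
Qed.

Lemma qeval_qform w (f : form A) : qeval w (qform f) = feval (w \o @Base A) f.
Proof. by elim: f => //= [f ->|f -> g ->|f -> g ->|f -> g ->]. Qed.

Lemma qeval_qset w (S : seq (form A)) :
  qeval w (qset S) <-> satisfies (w \o @Base A) (set_of_seq S).
Proof.
rewrite satisfies_set_of_seq qeval_qconj all_map.
rewrite (eq_all (a2 := feval (w \o @Base A))) // => f.
exact: qeval_qform.
Qed.

Lemma qeval_qle (I : eqType) w (t : seq I) (c : I -> gatom A)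
    (r : I -> form A) :
  qeval w (qle [seq qVar x | x <- [seq c i | i <- t]]
               [seq qform f | f <- [seq r i | i <- t]]) <->
  forall i, i \in t -> w (c i) -> feval (w \o @Base A) (r i).
Proof.
rewrite /qle -!map_comp zip_map qeval_qconj !all_map.
split=> [/allP tr i /tr /=|tr]; first by rewrite qeval_qform => /implyP.
by apply/allP => i ti /=; rewrite qeval_qform; apply/implyP/tr.
Qed.

Definition override v w (x : gatom A) : bool :=
  if x is Base a then v a else w x.

Lemma qeval_qexs_qatoms (s : seq A) q (P : (A -> bool) -> Prop) w :
    (forall v, qeval (override v w) q <-> P v) ->
    (forall v v', {in s, v =1 v'} -> P v -> P v') ->
  qeval w (qexs (qatoms s) q) <-> exists v, P v.
Proof.
move=> qP Ploc; rewrite qeval_qexs; split=> [[u uw uq]|[v Pv]].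
  exists (u \o @Base A); apply/qP; rewrite (@eq_qeval _ _ u) // => -[] //= i.
    by rewrite uw //; apply/mapP => -[].
  by rewrite uw //; apply/mapP => -[].
exists (override (fun a => if a \in s then v a else w (Base a)) w).
  case=> //= a; case: ifP => // sa.
  by rewrite /qatoms (map_f (@Base A)) // mem_undup.
by apply/qP; apply: Ploc Pv => a /= ->.
Qed.

Lemma qeval_qalls_qatoms (s : seq A) q (P : (A -> bool) -> Prop) w :
    (forall v, qeval (override v w) q <-> P v) ->
    (forall v v', {in s, v =1 v'} -> P v -> P v') ->
  qeval w (qalls (qatoms s) q) <-> forall v, P v.
Proof.
move=> qP Ploc.
have exNP : qeval w (qexs (qatoms s) (qNot q)) <-> exists v, ~ P v.
  apply: qeval_qexs_qatoms => [v|v v' eq_v]; first by rewrite qeval_qNot qP.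
  by apply/contra_not/Ploc => a /eq_v.
rewrite qeval_qallsE; split=> [/negP nex v|allP]; last by apply/negP => /exNP[].
by apply: contrapT => nPv; apply/nex/exNP; exists v.
Qed.

End EvaluationOfFormulas.

Section Modules.
Variable A : eqType.
Implicit Types (v : A -> bool) (w : gatom A -> bool) (f : form A).

Lemma qeval_qset_qle (I : eqType) v w (T0 : seq (form A)) (t : seq I)
    (c : I -> gatom A) (r : I -> form A) :
  (forall i a, c i <> Base a) ->
  qeval (override v w)
    (qAnd (qset T0) (qle [seq qVar x | x <- [seq c i | i <- t]]
                         [seq qform f | f <- [seq r i | i <- t]])) <->
  satisfies v (adjoin (set_of_seq T0) r [set i | i \in t /\ w (c i)]).
Proof.
move=> cB; have wc i : override v w (c i) = w (c i).
  by move: (cB i); case: (c i) => // a /(_ a).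
rewrite satisfies_adjoin qeval_qAnd qeval_qset qeval_qle.
split=> -[vT vr]; split=> // i; first by move=> [ti wi]; apply: vr; rewrite ?wc.
by rewrite wc => ti wi; apply: vr.
Qed.

Lemma qeval_C_mod (I : eqType) w (T0 : seq (form A)) (t : seq I)
    (c : I -> gatom A) (r : I -> form A) :
  (forall i a, c i <> Base a) ->
  qeval w (C_mod T0 [seq r i | i <- t] [seq c i | i <- t]) <->
  satisfiable (adjoin (set_of_seq T0) r [set i | i \in t /\ w (c i)]).
Proof.
move=> cB; apply: qeval_qexs_qatoms => [v|v v']; first exact: qeval_qset_qle.
apply: eq_satisfies_in; rewrite vars_cat; apply: var_within_adjoin.
  by apply: var_within_vars => a aT; rewrite mem_cat aT orbT.
by move=> i [/(var_subset_vars (r := r)) sub _] a /sub ar; rewrite mem_cat ar.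
Qed.

Definition guessed (n : nat) w : set 'I_n :=
  [set i | w (Guess (nat_of_ord i))].

Definition guessed' (n : nat) w : set 'I_n :=
  [set i | w (Guess' (nat_of_ord i))].

End Modules.

Section DefaultTheories.
Variables (A : eqType) (n : nat) (T : dtheory A n).
Implicit Types (w : gatom A -> bool) (X : set 'I_n) (f : form A).

Definition applicable_sets : set (set 'I_n) :=
  max_consistent (set_of_seq (facts T)) (@jus A \o dflt T).

Definition consequences X : fset A :=
  theory_of (set_of_seq (facts T)) (dflt T) X.

Lemma var_within_dtheory X :
  var_within (dtheory_var T)
    (adjoin (set_of_seq (facts T)) (@con A \o dflt T) X).
Proof.
apply: var_within_adjoin => [|i _ a ac].
  by apply: var_within_vars => a aT; rewrite mem_cat aT orbT.
rewrite mem_cat; apply/orP; left; apply/flatten_mapP.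
exists i; first by rewrite mem_enum.
by rewrite /default_var !mem_cat ac !orbT.
Qed.

Lemma guessed_enum w :
  [set i | i \in enum 'I_n /\ w (Guess (nat_of_ord i))] = guessed w.
Proof. by apply/predeqP => i; rewrite /= mem_enum; split=> [[]|]. Qed.

Lemma qeval_Conseq_mod f w :
  qeval w (Conseq_mod T f) <-> consequences (guessed w) f.
Proof.
rewrite /consequences theory_ofP.
apply: qeval_qalls_qatoms => [v|v v' eq_v vf v'T].
  rewrite /= [map _ (enum _)](map_comp (@qform A)) -guessed_enum.
  by rewrite -qeval_qset_qle // /= qeval_qform; split=> /implyP.
rewrite -(@eq_feval_in _ v) => [|a af]; last first.
  by apply: eq_v; rewrite mem_cat af orbT.
apply/vf/(eq_satisfies_in (@var_within_dtheory _) _ v'T) => a aT.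
by rewrite eq_v // mem_cat aT.
Qed.

Lemma qeval_qrename_Conseq_mod f w :
  qeval w (qrename (@prime_guess A) (Conseq_mod T f)) <->
  consequences (guessed' w) f.
Proof.
pose base (x : gatom A) := if x is Base _ then true else false.
rewrite (@qeval_qrename _ _ _ base); first exact: qeval_Conseq_mod.
  by case=> // a [] // b _ [->].
rewrite all_bound_qalls /= !all_bound_qconj all_bound_qform andbT.
rewrite -map_comp zip_map !all_map.
by apply/and3P; split; rewrite (eq_all (a2 := predT)) ?all_predT // => x;
  apply: all_bound_qform.
Qed.

Lemma qeval_C_mod_consistent w :
  qeval w (C_mod (facts T) [seq jus (dflt T i) | i <- enum 'I_n]
    (guesses A n)) <->
  satisfiable (adjoin (set_of_seq (facts T)) (@jus A \o dflt T) (guessed w)).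
Proof.
rewrite (@qeval_C_mod _ _ _ _ _ (fun i => Guess (nat_of_ord i))) //.
by rewrite guessed_enum.
Qed.

Lemma qeval_C_mod_addable w (i : 'I_n) : ~~ w (Guess i) ->
  qeval w (C_mod (rcons (facts T) (jus (dflt T i)))
    [seq jus (dflt T k) | k <- enum 'I_n & k != i]
    [seq Guess (nat_of_ord k) | k <- enum 'I_n & k != i]) <->
  exists2 v,
    satisfies v (adjoin (set_of_seq (facts T)) (@jus A \o dflt T) (guessed w)) &
    feval v (jus (dflt T i)).
Proof.
move=> ngi; rewrite (@qeval_C_mod _ _ _ _ _ (fun k => Guess (nat_of_ord k))) //.
split=> [[v /satisfies_adjoin[/satisfies_rcons[vT vi] vX]]|].
  exists v => //; apply/satisfies_adjoin; split=> // k gk; apply: vX.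
  by split=> //; rewrite mem_filter mem_enum andbT; apply: contraNneq ngi => <-.
move=> [v /satisfies_adjoin[vT vX] vi]; exists v; apply/satisfies_adjoin.
by rewrite satisfies_rcons; split=> // k [_ /vX].
Qed.

Lemma qeval_Ext_mod w : qeval w (Ext_mod T) <-> applicable_sets (guessed w).
Proof.
rewrite /Ext_mod [qeval _ _]/= qeval_qconj all_map.
split=> [/andP[/qeval_C_mod_consistent satX /allP maxX]|[satX maxX]].
  split=> // i v vX vi; apply: contraT => ngi; have := maxX i.
  rewrite mem_enum /= => /(_ isT)/implyP/(_ ngi)/negP[].
  by apply/(qeval_C_mod_addable ngi); exists v.
apply/andP; split; first exact/qeval_C_mod_consistent.
apply/allP => i _ /=; apply/implyP => ngi.
by apply/negP => /(qeval_C_mod_addable ngi)[v vX /(maxX i v vX)]; apply/negP.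
Qed.

Lemma qeval_Psi w : qeval w (Psi T) <->
  forall i : 'I_n, ~~ w (Guess' i) ->
    exists2 X, applicable_sets X & ~ consequences X (con (dflt T i)).
Proof.
have refutedE (i : 'I_n) : qeval w (qexs (guesses A n)
    (qAnd (Ext_mod T) (qNot (Conseq_mod T (con (dflt T i)))))) <->
    exists2 X, applicable_sets X & ~ consequences X (con (dflt T i)).
  rewrite exists2P; apply: (qeval_qexs_family (c := fun i : 'I_n => Guess i)).
    by move=> j k [/val_inj].
  by move=> u; rewrite qeval_qAnd qeval_qNot qeval_Ext_mod qeval_Conseq_mod.
rewrite /Psi qeval_qconj all_map; split=> [/allP allPsi i ngi|allPsi].
  by apply/refutedE; have := allPsi i; rewrite mem_enum /= ngi; apply.
by apply/allP => i _; apply/implyP => /allPsi/refutedE.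
Qed.

End DefaultTheories.

Section QBFCharacterizations.
Variables (A : eqType) (n : nat) (T T' : dtheory A n) (f : form A).

Lemma qvalid_credulous :
  qvalid (qexs (guesses A n) (qAnd (Ext_mod T) (Conseq_mod T' f))) <->
  exists2 X, applicable_sets T X & consequences T' X f.
Proof.
rewrite exists2P; apply: (qvalid_qexs_family (c := fun i : 'I_n => Guess i)).
  by move=> i j [/val_inj].
by move=> w; rewrite qeval_qAnd qeval_Ext_mod qeval_Conseq_mod.
Qed.

Lemma qvalid_skeptical :
  qvalid (qNot (qexs (guesses A n)
    (qAnd (Ext_mod T) (qNot (Conseq_mod T' f))))) <->
  forall X, applicable_sets T X -> consequences T' X f.
Proof.
rewrite (qvalid_qNot_qexs_family (c := fun i : 'I_n => Guess i)
  (P := fun X => applicable_sets T X /\ ~ consequences T' X f)).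
- by split=> allX X => [TX|[/allX]//]; apply: contrapT => nXf; apply: (allX X).
- by move=> i j [/val_inj].
- by move=> w; rewrite qeval_qAnd qeval_qNot qeval_Ext_mod qeval_Conseq_mod.
Qed.

Lemma consequences_mono (X Y : set 'I_n) :
  X `<=` Y -> consequences T' X f -> consequences T' Y f.
Proof. by move=> XY; apply/derives_mono/adjoin_mono. Qed.

Hypothesis T_supported : self_supporting (set_of_seq (facts T)) (dflt T).

Lemma qeval_Psi_subset w :
  qeval w (Psi T) <-> \bigcap_(X in applicable_sets T) X `<=` guessed' w.
Proof.
rewrite qeval_Psi; split=> [Psi_w i capi|sub i ngi].
  apply: contraT => /Psi_w[X TX]; case.
  by apply/(theory_of_con T_supported) => //; apply: capi.
apply: contrapT => nex; case/negP: ngi; apply: sub => X TX.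
apply: contrapT => nXi; apply: nex; exists X => //.
by move=> /(theory_of_con T_supported _ TX).
Qed.

Lemma qvalid_prudent :
  qvalid (qNot (qexs (guesses' A n) (qAnd (Psi T)
    (qNot (qrename (@prime_guess A) (Conseq_mod T' f)))))) <->
  consequences T' (\bigcap_(X in applicable_sets T) X) f.
Proof.
set common := \bigcap_(X in _) X.
rewrite (qvalid_qNot_qexs_family (c := fun i : 'I_n => Guess' i)
  (P := fun X => common `<=` X /\ ~ consequences T' X f)).
- split=> [allX|Cf X [/consequences_mono/(_ Cf)] //].
  by apply: contrapT => nCf; apply: (allX common); split.
- by move=> i j [/val_inj].
- move=> w; rewrite qeval_qAnd qeval_qNot qeval_Psi_subset.
  by rewrite qeval_qrename_Conseq_mod.
Qed.

End QBFCharacterizations.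

Section SignedAlphabet.
Variable Sigma : eqType.
Implicit Types (v : satom Sigma -> bool) (q : Sigma) (s : seq Sigma).
Implicit Types (f : form Sigma) (W : seq (form Sigma)).

Definition atom_of (a : satom Sigma) : Sigma :=
  match a with Orig q | Plus q | Minus q => q end.

Definition is_signed (a : satom Sigma) : bool :=
  if a is Orig _ then false else true.

Lemma var_signed_at b f a :
  a \in var (signed_at b f) -> is_signed a && (atom_of a \in var f).
Proof.
elim: f b => [q|f IH|f IHf g IHg|f IHf g IHg|f IHf g IHg] b /=.
- by case: b; rewrite !inE => /eqP -> /=.
- exact: IH.
all: by rewrite !mem_cat => /orP[/IHf|/IHg] /andP[-> ->]; rewrite ?orbT.
Qed.

Lemma vars_signed_seq W a :
  a \in vars (signed_seq W) -> is_signed a && (atom_of a \in vars W).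
Proof.
elim: W => //= f W IH; rewrite /vars /= !mem_cat.
by move=> /orP[/var_signed_at|/IH] /andP[-> ->]; rewrite ?orbT.
Qed.

(* Positive occurrences of p^+ and ~p^- become true, negative ones false. *)
Lemma feval_signed_at_true b f : feval xpredT (signed_at b f) = b.
Proof.
by elim: f b => [q|f IH|f IHf g IHg|f IHf g IHg|f IHf g IHg] b /=;
  rewrite ?IH ?IHf ?IHg; case: b.
Qed.

Lemma satisfiable_signed_seq W : satisfiable (set_of_seq (signed_seq W)).
Proof.
exists xpredT; apply/satisfies_set_of_seq; rewrite all_map.
rewrite (eq_all (a2 := predT)) ?all_predT // => f.
exact: feval_signed_at_true.
Qed.

Lemma eq_satisfies_signed_seq v v' W :
    (forall a, is_signed a -> atom_of a \in vars W -> v a = v' a) ->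
  satisfies v (set_of_seq (signed_seq W)) <->
  satisfies v' (set_of_seq (signed_seq W)).
Proof.
move=> eq_v; split; apply: (eq_satisfies_in (s := vars (signed_seq W))).
1,3: exact: var_within_vars.
all: by move=> a /vars_signed_seq/andP[sa Wa]; rewrite eq_v.
Qed.

Lemma feval_jus v q : feval v (jus (delta q)) = (v (Plus q) == ~~ v (Minus q)).
Proof. by rewrite /=; case: (v (Plus q)); case: (v (Minus q)). Qed.

Lemma feval_con v q : feval v (con (delta q)) =
  (v (Orig q) == v (Plus q)) && feval v (jus (delta q)).
Proof.
by rewrite /=; case: (v (Orig q)); case: (v (Plus q)); case: (v (Minus q)).
Qed.

Lemma con_delta_inj : injective (@con (satom Sigma) \o @delta Sigma).
Proof. by move=> q q' []. Qed.

Definition align v (a : satom Sigma) : bool :=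
  if a is Orig q then v (Plus q) else v a.

Lemma feval_align_con v q :
  feval (align v) (con (delta q)) = feval v (jus (delta q)).
Proof. by rewrite feval_con !feval_jus /= eqxx. Qed.

Lemma self_supporting_delta (I : Type) (p : I -> Sigma) W :
  self_supporting (set_of_seq (signed_seq W)) (fun i => delta (p i)).
Proof.
split=> [i v|v vW]; first by rewrite feval_con => /andP[].
exists (align v) => [|i]; last by rewrite feval_align_con.
by apply/(@eq_satisfies_signed_seq _ v) => // -[].
Qed.

Definition classical_outside s v (a : satom Sigma) : bool :=
  if atom_of a \in s then v a else if a is Minus _ then false else true.

Lemma feval_classical_jus s v q :
  feval (classical_outside s v) (jus (delta q)) =
  ((q \in s) ==> feval v (jus (delta q))).
Proof. by rewrite !feval_jus /classical_outside /=; case: ifP. Qed.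

Lemma feval_classical_con s v q :
  feval (classical_outside s v) (con (delta q)) =
  ((q \in s) ==> feval v (con (delta q))).
Proof.
by rewrite !feval_con !feval_jus /classical_outside /=; case: ifP.
Qed.

Lemma feval_classical_signed s v f : {subset var f <= s} ->
  feval (classical_outside s v) (signed f) = feval v (signed f).
Proof.
move=> fs; apply: eq_feval_in => a /var_signed_at/andP[_ /fs sa].
by rewrite /classical_outside sa.
Qed.

Lemma satisfies_classical_signed_seq s v W : {subset vars W <= s} ->
  satisfies (classical_outside s v) (set_of_seq (signed_seq W)) <->
  satisfies v (set_of_seq (signed_seq W)).
Proof.
move=> Ws; apply: eq_satisfies_signed_seq => a _ /Ws sa.
by rewrite /classical_outside sa.
Qed.

End SignedAlphabet.

Section SignedExtensions.
Variables (Sigma : eqType) (W : seq (form Sigma)).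
Local Notation V := (set_of_seq (signed_seq W)).

Definition applicable_atom_sets : set (set Sigma) :=
  max_consistent V (@jus _ \o @delta Sigma).

Lemma Pi_image (E : fset (satom Sigma)) :
  Pi E = (@con _ \o @delta Sigma) @` applied (@delta Sigma) E.
Proof.
by apply/predeqP => f; split=> [[q [-> Eq]]|[q Eq <-]]; exists q.
Qed.

Lemma applied_signed_ext :
  applied (@delta Sigma) @` signed_ext W = applicable_atom_sets.
Proof.
apply: applied_extensions => //; last exact: satisfiable_signed_seq.
exact: (self_supporting_delta id).
Qed.

Lemma cred_conseq_applicable_atom_sets f : cred_conseq W f <->
  exists2 Y, applicable_atom_sets Y & theory_of V (@delta Sigma) Y (signed f).
Proof.
rewrite -applied_signed_ext; split=> [[E [extE]]|[_ [E extE <-] EY]].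
  by rewrite Pi_image => EY; exists (applied (@delta Sigma) E) => //; exists E.
by exists E; rewrite Pi_image.
Qed.

Lemma skep_conseq_applicable_atom_sets f : skep_conseq W f <->
  forall Y, applicable_atom_sets Y -> theory_of V (@delta Sigma) Y (signed f).
Proof.
rewrite -applied_signed_ext; split=> [allE _ [E extE <-]|allY E extE].
  by have := allE E extE; rewrite Pi_image.
by rewrite Pi_image; apply: allY; exists E.
Qed.

Lemma prud_conseq_applicable_atom_sets f : prud_conseq W f <->
  theory_of V (@delta Sigma) (\bigcap_(Y in applicable_atom_sets) Y) (signed f).
Proof.
rewrite /prud_conseq; suff -> : (fun g => forall E, signed_ext W E -> Pi E g) =
    (@con _ \o @delta Sigma) @` (\bigcap_(Y in applicable_atom_sets) Y) by [].
have [Y0 Y0app] : exists Y, applicable_atom_sets Y.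
  exact/max_consistent_exists/satisfiable_signed_seq.
rewrite -applied_signed_ext in Y0app *; case: Y0app => E0 extE0 _.
rewrite bigcap_image; apply/predeqP => g; split=> [PiE|[q appq <-] E extE].
  have := PiE E0 extE0; rewrite Pi_image => -[q _ qg]; exists q => // E extE.
  have := PiE E extE; rewrite Pi_image -qg => -[q' appq' /con_delta_inj <-].
  exact: appq'.
by rewrite Pi_image; exists q => //; apply: appq.
Qed.

End SignedExtensions.

Section RestrictionToVariables.
Variables (Sigma : eqType) (W : seq (form Sigma)) (n : nat) (p : 'I_n -> Sigma).
Hypotheses (p_inj : injective p) (p_enum : codom p =i vars W).
Implicit Types (X : set 'I_n) (v : satom Sigma -> bool).
Local Notation V := (set_of_seq (signed_seq W)).

(* Atoms outside the range of [p] are vacuously selected. *)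
Definition selected X : set Sigma := [set q | forall i, p i = q -> X i].

Lemma selected_index X i : selected X (p i) <-> X i.
Proof. by split=> [/(_ i erefl)|Xi j /p_inj ->]. Qed.

Lemma selected_bigcap (C : set (set 'I_n)) :
  selected (\bigcap_(X in C) X) = \bigcap_(X in C) selected X.
Proof.
apply/predeqP => q; split=> [sel X CX i pi|sel i pi X CX].
  exact: sel pi X CX.
exact: sel X CX i pi.
Qed.

Lemma index_in_vars i : p i \in vars W.
Proof. by rewrite -p_enum codom_f. Qed.

Lemma satisfies_classical_selected X v :
  satisfies v (adjoin V (@jus _ \o dflt (thy p W)) X) ->
  satisfies (classical_outside (vars W) v)
    (adjoin V (@jus _ \o @delta Sigma) (selected X)).
Proof.
move=> /satisfies_adjoin[vW vX]; apply/satisfies_adjoin.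
split=> [|q selq]; first exact/satisfies_classical_signed_seq.
rewrite [feval _ _]feval_classical_jus -p_enum; apply/implyP => /codomP[i qi].
by rewrite qi; apply/vX/selq.
Qed.

Lemma satisfies_of_selected X v :
  satisfies v (adjoin V (@jus _ \o @delta Sigma) (selected X)) ->
  satisfies v (adjoin V (@jus _ \o dflt (thy p W)) X).
Proof.
move=> /satisfies_adjoin[vW vX]; apply/satisfies_adjoin; split=> // i Xi.
exact/vX/selected_index.
Qed.

Lemma applicable_atom_sets_notin_vars Y q :
  applicable_atom_sets W Y -> q \notin vars W -> Y q.
Proof.
move=> [[v /satisfies_adjoin[vW vY]] maxY] qW.
apply: (maxY q (classical_outside (vars W) v)); last first.
  by rewrite [feval _ _]feval_classical_jus (negbTE qW).
apply/satisfies_adjoin; split=> [|r /vY vr].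
  exact/satisfies_classical_signed_seq.
by rewrite [feval _ _]feval_classical_jus [feval _ _]vr implybT.
Qed.

Lemma selected_applicable_sets : selected @` applicable_sets (thy p W) =
  applicable_atom_sets W.
Proof.
apply/predeqP => Y; split=> [[X [[v vX] maxX] <-]|Ymax].
  split=> [|q v' /satisfies_of_selected v'X v'q i pi].
    exists (classical_outside (vars W) v).
    exact: satisfies_classical_selected.
  by apply: maxX v'X _; rewrite /= pi.
have selY : selected (p @^-1` Y) = Y.
  apply/predeqP => q; split=> [selq|Yq i pi]; last by rewrite /preimage /= pi.
  have [|/(applicable_atom_sets_notin_vars Ymax) //] := boolP (q \in vars W).
  by rewrite -p_enum => /codomP[i qi]; rewrite qi; apply: selq.
exists (p @^-1` Y) => //; rewrite -selY in Ymax; case: Ymax => -[v vY] maxY.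
split=> [|i v' v'X v'i]; first by exists v; apply: satisfies_of_selected.
apply/selected_index/(maxY _ _ (satisfies_classical_selected v'X)).
by rewrite [feval _ _]feval_classical_jus index_in_vars.
Qed.

Variable phi : form Sigma.

(* Consequents of atoms occurring in neither W nor phi are satisfied by       *)
(* changing the valuation at these atoms only.                                *)
Lemma theory_of_selected X :
  theory_of V (@delta Sigma) (selected X) (signed phi) <->
  consequences (thy' p W phi) X (signed phi).
Proof.
rewrite /consequences !theory_ofP; split=> allv v /satisfies_adjoin[].
  move=> /satisfies_set_of_seq; rewrite all_cat => /andP[].
  move=> /satisfies_set_of_seq vW; rewrite all_map => /allP vphi vX.
  pose s := vars W ++ var phi.
  rewrite -(@feval_classical_signed _ s) => [|q]; last first.
    by rewrite mem_cat orbC => ->.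
  apply/allv/satisfies_adjoin; split=> [|q selq].
    by apply/satisfies_classical_signed_seq => // q; rewrite mem_cat => ->.
  rewrite [feval _ _]feval_classical_con mem_cat; apply/implyP.
  have [|qW /= qphi] := boolP (q \in vars W).
    by rewrite -p_enum => /codomP[i qi] _; rewrite qi; apply/vX/selq.
  by apply: vphi; rewrite mem_filter qW mem_undup.
move=> vW vX; apply/allv/satisfies_adjoin.
split=> [|i Xi]; last exact/vX/selected_index.
apply/satisfies_set_of_seq; rewrite all_cat.
apply/andP; split; first exact/satisfies_set_of_seq.
rewrite all_map; apply/allP => q; rewrite mem_filter => /andP[qW _].
by apply: vX => i pi; rewrite -pi index_in_vars in qW.
Qed.

Lemma cred_conseqE : cred_conseq W phi <->
  exists2 X, applicable_sets (thy p W) X &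
    consequences (thy' p W phi) X (signed phi).
Proof.
rewrite cred_conseq_applicable_atom_sets -selected_applicable_sets.
split=> [[_ [X TX <-] /theory_of_selected]|[X TX /theory_of_selected]].
  by exists X.
by exists (selected X) => //; exists X.
Qed.

Lemma skep_conseqE : skep_conseq W phi <->
  forall X, applicable_sets (thy p W) X ->
    consequences (thy' p W phi) X (signed phi).
Proof.
rewrite skep_conseq_applicable_atom_sets -selected_applicable_sets.
split=> [allY X TX|allX _ [X TX <-]]; last exact/theory_of_selected/allX.
by apply/theory_of_selected/allY; exists X.
Qed.

Lemma prud_conseqE : prud_conseq W phi <->
  consequences (thy' p W phi) (\bigcap_(X in applicable_sets (thy p W)) X)
    (signed phi).
Proof.
rewrite prud_conseq_applicable_atom_sets -selected_applicable_sets bigcap_image.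
by rewrite -selected_bigcap; apply: theory_of_selected.
Qed.

End RestrictionToVariables.

Theorem theorem9 (Sigma : eqType) (W : seq (form Sigma)) (phi : form Sigma)
    (n : nat) (p : 'I_n -> Sigma)
    (p_inj : injective p) (p_enum : codom p =i vars W) :
  let T := thy p W in
  let T' := thy' p W phi in
  let G := guesses (satom Sigma) n in
  let G' := guesses' (satom Sigma) n in
  [/\ cred_conseq W phi <->
        qvalid (qexs G (qAnd (Ext_mod T) (Conseq_mod T' (signed phi)))),
      skep_conseq W phi <->
        qvalid (qNot (qexs G
          (qAnd (Ext_mod T) (qNot (Conseq_mod T' (signed phi))))))
    & prud_conseq W phi <->
        qvalid (qNot (qexs G'
          (qAnd (Psi T)
             (qNot (qrename (@prime_guess (satom Sigma))
                            (Conseq_mod T' (signed phi)))))))].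
Proof.
move=> T T' G G'; split.
- by rewrite (cred_conseqE p_inj p_enum) qvalid_credulous.
- by rewrite (skep_conseqE p_inj p_enum) qvalid_skeptical.
- rewrite (prud_conseqE p_inj p_enum) qvalid_prudent //.
  exact: self_supporting_delta.
Qed.
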